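(* Let $\omega\colon\mathbf Z_+\to(0,+\infty)$ be a weight which is bounded from below, such that $\sum_{n\ge0}1/\omega(k2^n)<+\infty$ for every $k\ge3$, and such that $\mathcal T$ is bounded on $\mathcal X_\omega$. Then $\mathcal T$ is frequently hypercyclic on $\mathcal X_\omega$: there exists $f\in\mathcal X_\omega$ such that for every nonempty open set $U\subset\mathcal X_\omega$, $\liminf_{N\to\infty}\frac{\#\{0\le n\le N:\ \mathcal T^nf\in U\}}{N+1}>0$. In particular this holds for $\omega=\omega_0$, $\omega_0(n)=(n+1)/\pi$.
   Context: $T\colon\mathbf Z_+\to\mathbf Z_+$ is the modified Collatz map: $T(n)=n/2$ for $n$ even, $T(n)=(3n+1)/2$ for $n$ odd. $\mathcal X_\omega$ is the Hilbert space of holomorphic functions $f(z)=\sum_{n\ge3}c_nz^n$ on the unit disk with $\|f\|_\omega^2=\sum_{n\ge3}|c_n|^2/\omega(n)<\infty$. $\mathcal T\sum_{n\ge3}c_nz^n=\sum_{j\ge3,\,T(j)\ge3}c_jz^{T(j)}$. $\mathcal T$ is bounded on $\mathcal X_\omega$ iff the sequences $\omega(6m)/\omega(3m)$, $\omega(6m+2)/\omega(3m+1)$, $(\omega(6m+4)+\omega(2m+1))/\omega(3m+2)$ ($m\ge1$) are bounded; this holds for $\omega_0$. *)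

(* Defs.v *)
From Stdlib Require Import Reals Lra Lia Arith ClassicalEpsilon.
From Coquelicot Require Import Coquelicot.
Open Scope R_scope.

Definition collatz (n : nat) : nat :=
  if Nat.even n then (n / 2)%nat else ((3 * n + 1) / 2)%nat.

Fixpoint csum (f : nat -> C) (n : nat) : C :=
  match n with
  | O => 0%C
  | S m => Cplus (csum f m) (f m)
  end.

(* Elements of X_omega are represented by their Taylor coefficient
   sequences c : nat -> C (f(z) = sum_n c_n z^n). *)
Definition coef := nat -> C.

(* The operator  sum_{n>=3} c_n z^n  |->  sum_{j>=3, T(j)>=3} c_j z^{T(j)}.
   Coefficient k (k >= 3) of the image is the sum of c_j over j >= 3 with
   T(j) = k; all such j satisfy j <= 2k. *)
Definition Top (c : coef) : coef := fun k =>
  if Nat.ltb k 3 then 0%C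
  else csum (fun j => if andb (Nat.leb 3 j) (Nat.eqb (collatz j) k)
                      then c j else 0%C) (2 * k + 1).

(* f = sum_{n>=3} c_n z^n is holomorphic on the unit disk
   (radius of convergence >= 1) and ||f||_omega^2 = sum |c_n|^2/omega(n) < oo *)
Definition inX (w : nat -> R) (c : coef) : Prop :=
  (forall n, (n < 3)%nat -> c n = 0%C) /\
  (forall r, 0 <= r < 1 -> ex_series (fun n => Cmod (c n) * r ^ n)) /\
  ex_series (fun n => (Cmod (c n)) ^ 2 / w n).

Definition xnorm (w : nat -> R) (c : coef) : R :=
  sqrt (Series (fun n => (Cmod (c n)) ^ 2 / w n)).

Definition csub (c d : coef) : coef := fun n => Cminus (c n) (d n).

Definition openX (w : nat -> R) (U : coef -> Prop) : Prop :=
  (forall g, U g -> inX w g) /\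
  (forall g, U g -> exists eps, 0 < eps /\
     forall h, inX w h -> xnorm w (csub h g) < eps -> U h).

Definition Top_bounded (w : nat -> R) : Prop :=
  (forall f, inX w f -> inX w (Top f)) /\
  exists M, forall f, inX w f -> xnorm w (Top f) <= M * xnorm w f.

Fixpoint count_upto (P : nat -> Prop) (N : nat) : R :=
  let here := if excluded_middle_informative (P N) then 1 else 0 in
  match N with
  | O => here
  | S M => count_upto P M + here
  end.

Definition frequently_hypercyclic (w : nat -> R) : Prop :=
  exists f, inX w f /\
    forall U, openX w U -> (exists g, U g) ->
      Rbar_lt (Finite 0)
        (LimInf_seq (fun N => count_upto (fun n => U (Nat.iter n Top f)) N
                              / INR (N + 1))).

Definition omega0 (n : nat) : R := (INR n + 1) / PI.

(* Main.v *)
(* Let S be the right inverse z^k |-> z^(2k) of the operator T.  A frequently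
   hypercyclic vector is f = sum_n S^n x_n, where x_n runs through a dense
   sequence p_s of polynomials with T^N p_s = 0 for large N, x_n being p_s on a set
   of positive lower density and x_n = 0 elsewhere.  These sets are so separated
   that T^n f = p_s + sum_(m>0) S^m x_(n+m) there (the earlier terms have died),
   and that the terms of the last sum have disjoint supports, so that their squared
   norms add up; summability of 1/omega(k 2^n) makes the total small.  Disjointness
   of supports also bounds the coefficients of f linearly, so f is holomorphic
   although the space need not be complete.

   Density of the killed polynomials does not depend on the Collatz conjecture: m
   and V(m) > m, where V(k 2^a) = (3k+1) 2^a for odd k, have the same image after
   a+1 steps, so z^m is approximated by its differences with the averages of
   z^(V^j(m)), whose norms tend to 0 because omega is bounded from below. *)
Require Import Defs.
From Stdlib Require Import Reals Lra Lia Arith NArith ClassicalEpsilon.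
From Stdlib Require Import FunctionalExtensionality Cantor List.
From Coquelicot Require Import Coquelicot.
Open Scope R_scope.

(** * Finite sums *)

Fixpoint rsum (u : nat -> R) (n : nat) : R :=
  match n with
  | O => 0
  | S m => rsum u m + u m
  end.

Lemma rsum_le (u v : nat -> R) (n : nat) :
  (forall i, (i < n)%nat -> u i <= v i) -> rsum u n <= rsum v n.
Proof.
  induction n as [|n IH]; simpl; intros H; [lra|].
  assert (u n <= v n) by (apply H; lia).
  assert (rsum u n <= rsum v n) by (apply IH; intros; apply H; lia).
  lra.
Qed.

Lemma rsum_ext (u v : nat -> R) (n : nat) :
  (forall i, (i < n)%nat -> u i = v i) -> rsum u n = rsum v n.
Proof.
  intros H; apply Rle_antisym; apply rsum_le; intros i Hi; rewrite (H i Hi); lra.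
Qed.

Lemma rsum_0 (n : nat) : rsum (fun _ => 0) n = 0.
Proof. induction n; simpl; lra. Qed.

Lemma rsum_ge0 (u : nat -> R) (n : nat) :
  (forall i, (i < n)%nat -> 0 <= u i) -> 0 <= rsum u n.
Proof. intros H; rewrite <- (rsum_0 n); apply rsum_le; exact H. Qed.

Lemma rsum_plus (u v : nat -> R) (n : nat) :
  rsum (fun i => u i + v i) n = rsum u n + rsum v n.
Proof. induction n; simpl; lra. Qed.

Lemma rsum_scal (a : R) (u : nat -> R) (n : nat) :
  rsum (fun i => a * u i) n = a * rsum u n.
Proof. induction n as [|n IH]; simpl; [lra|rewrite IH; lra]. Qed.

Lemma rsum_monotone (u : nat -> R) (m n : nat) :
  (forall i, 0 <= u i) -> (m <= n)%nat -> rsum u m <= rsum u n.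
Proof.
  intros H; induction 1 as [|n _ IH]; simpl; [lra|].
  specialize (H n); lra.
Qed.

Lemma rsum_extend (u : nat -> R) (m n : nat) :
  (m <= n)%nat -> (forall i, (m <= i)%nat -> u i = 0) -> rsum u n = rsum u m.
Proof.
  intros Hmn H; induction Hmn as [|n Hmn IH]; [reflexivity|].
  simpl; rewrite IH, H by exact Hmn; ring.
Qed.

Lemma rsum_exchange (F : nat -> nat -> R) (m n : nat) :
  rsum (fun i => rsum (F i) n) m = rsum (fun j => rsum (fun i => F i j) m) n.
Proof.
  induction m as [|m IH]; simpl.
  - now rewrite rsum_0.
  - now rewrite IH, rsum_plus.
Qed.

Lemma rsum_term_le (u : nat -> R) (i n : nat) :
  (forall j, 0 <= u j) -> (i < n)%nat -> u i <= rsum u n.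
Proof.
  intros H Hi.
  apply Rle_trans with (rsum u (S i)); [|now apply rsum_monotone].
  simpl; assert (0 <= rsum u i) by (now apply rsum_ge0); lra.
Qed.

Lemma rsum_double (u : nat -> R) (n : nat) :
  rsum u (2 * n) = rsum (fun i => u (2 * i)%nat) n + rsum (fun i => u (2 * i + 1)%nat) n.
Proof.
  induction n as [|n IH]; [simpl; lra|].
  replace (2 * S n)%nat with (S (S (2 * n))) by lia.
  cbn [rsum]; rewrite IH.
  replace (S (2 * n)) with (2 * n + 1)%nat by lia. lra.
Qed.

Lemma sum_n_rsum (u : nat -> R) (n : nat) : sum_n u n = rsum u (S n).
Proof.
  induction n as [|n IH].
  - rewrite sum_O; simpl; lra.
  - rewrite sum_Sn, IH; reflexivity.
Qed.

Lemma bounded_ex_series (u : nat -> R) (B : R) :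
  (forall n, 0 <= u n) -> (forall n, rsum u n <= B) ->
  ex_series u /\ Series u <= B.
Proof.
  intros Hu HB.
  assert (Hex : ex_finite_lim_seq (sum_n u)).
  { apply ex_finite_lim_seq_incr with B; intros n; rewrite !sum_n_rsum.
    - apply rsum_monotone; [exact Hu|lia].
    - apply HB. }
  destruct Hex as [l Hl].
  assert (Hs : is_series u l) by exact Hl.
  split; [now exists l|].
  rewrite (is_series_unique _ _ Hs).
  apply (is_lim_seq_le (sum_n u) (fun _ => B) l B); [|exact Hl|apply is_lim_seq_const].
  intros n; rewrite sum_n_rsum; apply HB.
Qed.

Lemma rsum_le_Series (u : nat -> R) (n : nat) :
  (forall i, 0 <= u i) -> ex_series u -> rsum u n <= Series u.
Proof.
  intros Hu Hex.
  apply Rle_trans with (rsum u (S n)); [apply rsum_monotone; [exact Hu|lia]|].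
  rewrite <- sum_n_rsum.
  apply (is_lim_seq_incr_compare (sum_n u) (Series u)).
  - apply (Series_correct _ Hex).
  - intros m; rewrite !sum_n_rsum; apply rsum_monotone; [exact Hu|lia].
Qed.

Lemma rsum_tail_small (u : nat -> R) (B : R) :
  (forall n, 0 <= u n) -> (forall n, rsum u n <= B) ->
  forall eps, 0 < eps -> exists L, forall M n, (L <= M)%nat ->
    rsum (fun i => if (M <=? i)%nat then u i else 0) n <= eps.
Proof.
  intros Hu HB eps Heps.
  destruct (completeness (fun x => exists n, x = rsum u n)) as [l [Hub Hlub]].
  - exists B; intros x [n ->]; apply HB.
  - exists 0, 0%nat; reflexivity.
  - assert (HL : exists L, l - eps < rsum u L).
    { apply NNPP; intros H.
      assert (l <= l - eps); [|lra].
      apply Hlub; intros x [n ->].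
      apply Rnot_lt_le; intros H'; apply H; now exists n. }
    destruct HL as [L HL]; exists L; intros M n HM.
    assert (Hlow : rsum (fun i => if (M <=? i)%nat then u i else 0) n <=
                   rsum (fun i => if (L <=? i)%nat then u i else 0) n).
    { apply rsum_le; intros i _.
      destruct (Nat.leb_spec M i); destruct (Nat.leb_spec L i); try lia; try lra.
      apply Hu. }
    assert (Hsplit : rsum (fun i => if (L <=? i)%nat then u i else 0) n =
                     rsum u (Nat.max n L) - rsum u L).
    { clear Hlow; induction n as [|n IH].
      - simpl; lra.
      - cbn [rsum]; rewrite IH.
        destruct (Nat.leb_spec L n).
        + rewrite !Nat.max_l by lia; cbn [rsum]; lra.
        + rewrite !Nat.max_r by lia; lra. }
    assert (rsum u (Nat.max n L) <= l) by (apply Hub; now exists (Nat.max n L)).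
    lra.
Qed.

Lemma csum_ext (f g : nat -> C) (n : nat) :
  (forall i, (i < n)%nat -> f i = g i) -> csum f n = csum g n.
Proof.
  induction n as [|n IH]; simpl; intros H; [reflexivity|].
  rewrite IH by (intros; apply H; lia).
  now rewrite H by lia.
Qed.

Lemma csum_eq0 (f : nat -> C) (n : nat) :
  (forall i, (i < n)%nat -> f i = 0%C) -> csum f n = 0%C.
Proof.
  induction n as [|n IH]; simpl; intros H; [reflexivity|].
  rewrite IH by (intros; apply H; lia).
  rewrite H by lia. apply Cplus_0_l.
Qed.

Lemma csum_plus (f g : nat -> C) (n : nat) :
  csum (fun i => Cplus (f i) (g i)) n = Cplus (csum f n) (csum g n).
Proof.
  induction n as [|n IH]; simpl; [now rewrite Cplus_0_l|].
  rewrite IH; ring.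
Qed.

Lemma csum_single (f : nat -> C) (a n : nat) :
  csum (fun i => if (i =? a)%nat then f i else 0%C) n =
  if (a <? n)%nat then f a else 0%C.
Proof.
  induction n as [|n IH]; [reflexivity|].
  cbn [csum]; rewrite IH.
  destruct (Nat.eqb_spec n a); destruct (Nat.ltb_spec a n);
    destruct (Nat.ltb_spec a (S n)); subst; try lia; ring.
Qed.

Lemma csum_extend (f : nat -> C) (m n : nat) :
  (m <= n)%nat -> (forall i, (m <= i)%nat -> f i = 0%C) -> csum f n = csum f m.
Proof.
  intros Hmn H; induction Hmn as [|n Hmn IH]; [reflexivity|].
  simpl; rewrite IH, H by exact Hmn; apply Cplus_0_r.
Qed.

Lemma csum_shift (f : nat -> C) (n : nat) :
  csum f (S n) = Cplus (f 0%nat) (csum (fun i => f (S i)) n).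
Proof.
  induction n as [|n IH]; [simpl; ring|].
  change (csum f (S (S n))) with (Cplus (csum f (S n)) (f (S n))).
  rewrite IH; simpl; ring.
Qed.

Lemma csum_disjoint_sqr (f : nat -> C) (n : nat) :
  (forall i j, (i < j)%nat -> f i = 0%C \/ f j = 0%C) ->
  Cmod (csum f n) ^ 2 = rsum (fun i => Cmod (f i) ^ 2) n.
Proof.
  intros H; induction n as [|n IH]; cbn [csum rsum].
  - rewrite Cmod_0; ring.
  - destruct (excluded_middle_informative (f n = 0%C)) as [Hn|Hn].
    + rewrite Hn, Cplus_0_r, IH, Cmod_0; ring.
    + assert (H0 : forall i, (i < n)%nat -> f i = 0%C).
      { intros i Hi; destruct (H i n Hi); tauto. }
      rewrite (csum_eq0 f n H0), Cplus_0_l.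
      rewrite (rsum_ext _ (fun _ => 0)), rsum_0; [ring|].
      intros i Hi; rewrite (H0 i Hi), Cmod_0; ring.
Qed.

Lemma csum_disjoint_bound (f : nat -> C) (n : nat) (B : R) :
  (forall i j, (i < j)%nat -> f i = 0%C \/ f j = 0%C) -> 0 <= B ->
  (forall i, (i < n)%nat -> Cmod (f i) <= B) -> Cmod (csum f n) <= B.
Proof.
  intros H HB; induction n as [|n IH]; cbn [csum]; intros Hf.
  - now rewrite Cmod_0.
  - destruct (excluded_middle_informative (f n = 0%C)) as [Hn|Hn].
    + rewrite Hn, Cplus_0_r; apply IH; intros; apply Hf; lia.
    + rewrite csum_eq0, Cplus_0_l; [apply Hf; lia|].
      intros i Hi; destruct (H i n Hi); tauto.
Qed.

(** * The operator and its right inverse *)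

Lemma collatz_even (n : nat) : collatz (2 * n) = n.
Proof.
  unfold collatz; replace (Nat.even (2 * n)) with true.
  - now rewrite Nat.mul_comm, Nat.div_mul.
  - symmetry; apply Nat.even_spec; now exists n.
Qed.

Lemma collatz_odd (n : nat) : collatz (2 * n + 1) = (3 * n + 2)%nat.
Proof.
  unfold collatz; replace (Nat.even (2 * n + 1)) with false.
  - replace (3 * (2 * n + 1) + 1)%nat with ((3 * n + 2) * 2)%nat by lia.
    now apply Nat.div_mul.
  - symmetry; rewrite <- Nat.negb_odd; apply Bool.negb_false_iff.
    apply Nat.odd_spec; now exists n.
Qed.

Definition odd_part (c : coef) : coef := fun k =>
  if (k mod 3 =? 2)%nat then c (2 * (k / 3) + 1)%nat else 0%C.

Lemma Top_eq (c : coef) (k : nat) :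
  Top c k = if (k <? 3)%nat then 0%C else Cplus (c (2 * k)%nat) (odd_part c k).
Proof.
  unfold Top, odd_part; destruct (Nat.ltb_spec k 3) as [|Hk]; [reflexivity|].
  set (a := (2 * (k / 3) + 1)%nat).
  assert (Hdiv := Nat.div_mod_eq k 3).
  assert (Hmod := Nat.mod_upper_bound k 3).
  set (g := fun j => if (j =? a)%nat then if (k mod 3 =? 2)%nat then c j else 0%C else 0%C).
  rewrite (csum_ext _ (fun j => Cplus (if (j =? 2 * k)%nat then c j else 0%C) (g j))).
  - rewrite csum_plus, csum_single.
    unfold g; rewrite (csum_single (fun j => if (k mod 3 =? 2)%nat then c j else 0%C)).
    destruct (Nat.ltb_spec (2 * k) (2 * k + 1)); [|lia].
    destruct (Nat.ltb_spec a (2 * k + 1)); [reflexivity|unfold a in *; lia].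
  - intros j Hj; unfold g.
    destruct (Nat.Even_or_Odd j) as [[i ->]|[i ->]].
    + rewrite collatz_even.
      destruct (Nat.eqb_spec (2 * i) a); [unfold a in *; lia|].
      destruct (Nat.eqb_spec i k) as [->|].
      * rewrite Nat.eqb_refl; destruct (Nat.leb_spec 3 (2 * k)); [simpl; ring|lia].
      * rewrite Bool.andb_false_r.
        destruct (Nat.eqb_spec (2 * i) (2 * k)); [lia|ring].
    + rewrite collatz_odd.
      destruct (Nat.eqb_spec (2 * i + 1) (2 * k)); [lia|].
      destruct (Nat.eqb_spec (3 * i + 2) k) as [e|ne].
      * destruct (Nat.leb_spec 3 (2 * i + 1)); [|lia].
        destruct (Nat.eqb_spec (k mod 3) 2); [|lia].
        destruct (Nat.eqb_spec (2 * i + 1) a); [simpl; ring|unfold a in *; lia].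
      * rewrite Bool.andb_false_r.
        destruct (Nat.eqb_spec (2 * i + 1) a); [|ring].
        destruct (Nat.eqb_spec (k mod 3) 2); [unfold a in *; lia|ring].
Qed.

Definition czero : coef := fun _ => 0%C.
Definition cadd (c d : coef) : coef := fun n => Cplus (c n) (d n).

Definition dbl (c : coef) : coef := fun j => if Nat.even j then c (Nat.div2 j) else 0%C.

Definition from3 (c : coef) : Prop := forall n, (n < 3)%nat -> c n = 0%C.

Lemma dbl_even (c : coef) (n : nat) : dbl c (2 * n)%nat = c n.
Proof.
  unfold dbl; rewrite Nat.div2_double.
  now replace (Nat.even (2 * n)) with true by (symmetry; apply Nat.even_spec; now exists n).
Qed.

Lemma dbl_odd (c : coef) (n : nat) : dbl c (2 * n + 1)%nat = 0%C.
Proof.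
  unfold dbl; replace (Nat.even (2 * n + 1)) with false; [reflexivity|].
  symmetry; rewrite <- Nat.negb_odd; apply Bool.negb_false_iff.
  apply Nat.odd_spec; now exists n.
Qed.

Lemma cadd_0_l (c : coef) : cadd czero c = c.
Proof. apply functional_extensionality; intros n; apply Cplus_0_l. Qed.

Lemma Top_0 : Top czero = czero.
Proof.
  apply functional_extensionality; intros k; rewrite Top_eq; unfold odd_part, czero.
  destruct (k <? 3)%nat, (k mod 3 =? 2)%nat; try reflexivity; ring.
Qed.

Lemma Top_add (c d : coef) : Top (cadd c d) = cadd (Top c) (Top d).
Proof.
  apply functional_extensionality; intros k; unfold cadd; rewrite !Top_eq; unfold odd_part.
  destruct (k <? 3)%nat, (k mod 3 =? 2)%nat; ring.
Qed.

Lemma Top_dbl (c : coef) : from3 c -> Top (dbl c) = c.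
Proof.
  intros Hc; apply functional_extensionality; intros k; rewrite Top_eq; unfold odd_part.
  destruct (Nat.ltb_spec k 3); [now rewrite Hc|].
  rewrite dbl_even, dbl_odd; destruct (k mod 3 =? 2)%nat; ring.
Qed.

Lemma dbl_add (c d : coef) : dbl (cadd c d) = cadd (dbl c) (dbl d).
Proof.
  apply functional_extensionality; intros k; unfold cadd, dbl.
  destruct (Nat.even k); ring.
Qed.

Lemma iter_Top_0 (n : nat) : Nat.iter n Top czero = czero.
Proof. induction n as [|n IH]; simpl; [reflexivity|now rewrite IH, Top_0]. Qed.

Lemma iter_Top_add (n : nat) (c d : coef) :
  Nat.iter n Top (cadd c d) = cadd (Nat.iter n Top c) (Nat.iter n Top d).
Proof. induction n as [|n IH]; simpl; [reflexivity|now rewrite IH, Top_add]. Qed.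

Lemma iter_dbl_add (n : nat) (c d : coef) :
  Nat.iter n dbl (cadd c d) = cadd (Nat.iter n dbl c) (Nat.iter n dbl d).
Proof. induction n as [|n IH]; simpl; [reflexivity|now rewrite IH, dbl_add]. Qed.

Lemma iter_Top_stable (c : coef) (m n : nat) :
  (m <= n)%nat -> Nat.iter m Top c = czero -> Nat.iter n Top c = czero.
Proof.
  intros Hmn H; replace n with ((n - m) + m)%nat by lia.
  rewrite Nat.iter_add, H; apply iter_Top_0.
Qed.

Lemma iter_dbl_low (c : coef) (n j : nat) :
  from3 c -> (j < 3 + n)%nat -> Nat.iter n dbl c j = 0%C.
Proof.
  intros Hc; revert j; induction n as [|n IH]; intros j Hj; [apply Hc; lia|].
  change (dbl (Nat.iter n dbl c) j = 0%C).
  destruct (Nat.Even_or_Odd j) as [[i ->]|[i ->]].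
  - rewrite dbl_even; apply IH; lia.
  - apply dbl_odd.
Qed.

Lemma iter_Top_dbl (c : coef) (m n : nat) :
  from3 c -> (m <= n)%nat ->
  Nat.iter n Top (Nat.iter m dbl c) = Nat.iter (n - m) Top c.
Proof.
  intros Hc; revert n; induction m as [|m IH]; intros n Hmn.
  - now rewrite Nat.sub_0_r.
  - destruct n as [|n]; [lia|].
    rewrite Nat.iter_succ_r.
    change (Nat.iter (S m) dbl c) with (dbl (Nat.iter m dbl c)).
    rewrite Top_dbl; [apply IH; lia|].
    intros j Hj; apply iter_dbl_low; [exact Hc|lia].
Qed.

Lemma iter_dbl_neq0 (c : coef) (n j : nat) :
  Nat.iter n dbl c j <> 0%C -> exists k, j = (k * 2 ^ n)%nat /\ c k <> 0%C.
Proof.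
  revert j; induction n as [|n IH]; intros j H.
  - exists j; split; [simpl; lia|exact H].
  - change (dbl (Nat.iter n dbl c) j <> 0%C) in H.
    destruct (Nat.Even_or_Odd j) as [[i ->]|[i ->]].
    + rewrite dbl_even in H; destruct (IH i H) as [k [-> Hk]].
      exists k; split; [simpl; lia|exact Hk].
    + now rewrite dbl_odd in H.
Qed.

Lemma iter_dbl_bound (c : coef) (n j : nat) (B : R) :
  0 <= B -> (forall k, Cmod (c k) <= B) -> Cmod (Nat.iter n dbl c j) <= B.
Proof.
  intros HB Hc; revert j; induction n as [|n IH]; intros j; [apply Hc|].
  change (Cmod (dbl (Nat.iter n dbl c) j) <= B).
  unfold dbl at 1; destruct (Nat.even j); [apply IH|now rewrite Cmod_0].
Qed.

Definition diag_sum (y : nat -> coef) : coef := fun j => csum (fun n => y n j) (S j).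

Lemma diag_sum_shift (x : nat -> coef) (i : nat) :
  (forall n, from3 (x n)) ->
  diag_sum (fun n => Nat.iter n dbl (x (i + n)%nat)) =
  cadd (x i) (dbl (diag_sum (fun n => Nat.iter n dbl (x (S i + n)%nat)))).
Proof.
  intros Hx; apply functional_extensionality; intros j; unfold cadd, diag_sum at 1.
  rewrite csum_shift; f_equal; [now rewrite Nat.add_0_r|].
  destruct (Nat.Even_or_Odd j) as [[k ->]|[k ->]].
  - rewrite dbl_even; unfold diag_sum.
    rewrite (csum_ext _ (fun n => Nat.iter n dbl (x (S i + n)%nat) k)).
    + destruct (Nat.eq_dec k 0) as [->|Hk].
      * simpl; rewrite Hx by lia; ring.
      * apply csum_extend; [lia|].
        intros n Hn; apply iter_dbl_low; [apply Hx|lia].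
    + intros n Hn; rewrite <- plus_n_Sm; exact (dbl_even (Nat.iter n dbl (x (S i + n)%nat)) k).
  - rewrite dbl_odd; apply csum_eq0; intros n _; apply dbl_odd.
Qed.

(* The terms x_n with n < i have died under [Top^i]; the others are shifted down. *)
Lemma iter_Top_diag_sum (x : nat -> coef) (i : nat) :
  (forall n, from3 (x n)) ->
  (forall n, (n < i)%nat -> Nat.iter (i - n) Top (x n) = czero) ->
  Nat.iter i Top (diag_sum (fun n => Nat.iter n dbl (x n))) =
  diag_sum (fun n => Nat.iter n dbl (x (i + n)%nat)).
Proof.
  intros Hx Hkill.
  set (tail := fun k => diag_sum (fun n => Nat.iter n dbl (x (k + n)%nat))).
  assert (Htail : forall k, from3 (tail k)).
  { intros k j Hj; apply csum_eq0; intros n _.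
    apply iter_dbl_low; [apply Hx|lia]. }
  assert (H : forall k, (k <= i)%nat -> exists d,
             Nat.iter i Top d = czero /\ tail 0%nat = cadd d (Nat.iter k dbl (tail k))).
  { induction k as [|k IH]; intros Hk.
    - exists czero; split; [apply iter_Top_0|now rewrite cadd_0_l].
    - destruct IH as [d [Hd Ht]]; [lia|].
      exists (cadd d (Nat.iter k dbl (x k))); split.
      + rewrite iter_Top_add, Hd, iter_Top_dbl, Hkill by (try apply Hx; lia).
        apply cadd_0_l.
      + rewrite Ht; unfold tail at 1; rewrite diag_sum_shift by exact Hx.
        rewrite iter_dbl_add, <- Nat.iter_succ_r.
        apply functional_extensionality; intros j; unfold cadd; fold (tail (S k)); ring. }
  destruct (H i (le_n i)) as [d [Hd Ht]].
  fold (tail i); change (Nat.iter i Top (tail 0%nat) = tail i).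
  rewrite Ht, iter_Top_add, Hd, cadd_0_l, iter_Top_dbl by (try apply Htail; lia).
  now rewrite Nat.sub_diag.
Qed.

(** * Weighted square norms *)

Definition sqn (v : nat -> R) (c : coef) (J : nat) : R :=
  rsum (fun j => Cmod (c j) ^ 2 * v j) J.

Lemma sqn_term_ge0 (v : nat -> R) (c : coef) (j : nat) :
  0 <= v j -> 0 <= Cmod (c j) ^ 2 * v j.
Proof. intros Hv; apply Rmult_le_pos; [apply pow2_ge_0|exact Hv]. Qed.

Lemma sqn_monotone (v : nat -> R) (c : coef) (J K : nat) :
  (forall n, 0 <= v n) -> (J <= K)%nat -> sqn v c J <= sqn v c K.
Proof. intros Hv; apply rsum_monotone; intros; now apply sqn_term_ge0. Qed.

Lemma Cmod_add_sqr_le (a b : C) :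
  Cmod (Cplus a b) ^ 2 <= 2 * Cmod a ^ 2 + 2 * Cmod b ^ 2.
Proof.
  assert (H := Cmod_triangle a b); assert (H0 := Cmod_ge_0 (Cplus a b)).
  assert (Cmod (Cplus a b) ^ 2 <= (Cmod a + Cmod b) ^ 2) by (apply pow_incr; lra).
  assert (0 <= (Cmod a - Cmod b) ^ 2) by apply pow2_ge_0.
  nra.
Qed.

Lemma sqn_add_le (v : nat -> R) (c d : coef) (J : nat) :
  (forall n, 0 <= v n) -> sqn v (cadd c d) J <= 2 * sqn v c J + 2 * sqn v d J.
Proof.
  intros Hv; unfold sqn; rewrite <- !rsum_scal, <- rsum_plus.
  apply rsum_le; intros j _; unfold cadd.
  assert (H := Rmult_le_compat_r _ _ _ (Hv j) (Cmod_add_sqr_le (c j) (d j))); lra.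
Qed.

Lemma sqn_dbl (v : nat -> R) (c : coef) (J : nat) :
  sqn v (dbl c) (2 * J) = sqn (fun k => v (2 * k)%nat) c J.
Proof.
  unfold sqn; rewrite rsum_double.
  rewrite (rsum_ext (fun i => _ ^ 2 * v (2 * i + 1)%nat) (fun _ => 0)).
  - rewrite rsum_0, Rplus_0_r; apply rsum_ext; intros i _; now rewrite dbl_even.
  - intros i _; rewrite dbl_odd, Cmod_0; ring.
Qed.

Lemma sqn_iter_dbl_le (v : nat -> R) (c : coef) (n B J : nat) :
  (forall k, 0 <= v k) -> (forall k, (B <= k)%nat -> c k = 0%C) ->
  sqn v (Nat.iter n dbl c) J <= sqn (fun k => v (k * 2 ^ n)%nat) c B.
Proof.
  intros Hv Hc; revert v Hv J; induction n as [|n IH]; intros v Hv J.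
  - apply Rle_trans with (sqn v c (Nat.max J B)); [apply sqn_monotone; [exact Hv|lia]|].
    right; unfold sqn; rewrite (rsum_extend _ B) by
      (try lia; intros i Hi; rewrite Hc by exact Hi; rewrite Cmod_0; ring).
    apply rsum_ext; intros i _; now rewrite Nat.mul_1_r.
  - apply Rle_trans with (sqn v (dbl (Nat.iter n dbl c)) (2 * J)).
    + apply sqn_monotone; [exact Hv|lia].
    + rewrite sqn_dbl; eapply Rle_trans; [apply IH; intros; apply Hv|].
      right; apply rsum_ext; intros k _; do 2 f_equal; simpl; lia.
Qed.

Lemma sqn_diag_sum_le (v : nat -> R) (y : nat -> coef) (b : nat -> R) (J : nat) :
  (forall n, 0 <= v n) ->
  (forall m n j, (m < n)%nat -> y m j = 0%C \/ y n j = 0%C) ->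
  (forall n, sqn v (y n) J <= b n) ->
  sqn v (diag_sum y) J <= rsum b J.
Proof.
  intros Hv Hdisj Hb.
  apply Rle_trans with (rsum (fun n => sqn v (y n) J) J); [|apply rsum_le; intros; apply Hb].
  unfold sqn at 2; rewrite rsum_exchange.
  apply rsum_le; intros j Hj; unfold diag_sum.
  rewrite csum_disjoint_sqr by (intros; now apply Hdisj).
  rewrite Rmult_comm, <- rsum_scal.
  apply Rle_trans with (rsum (fun i => v j * Cmod (y i j) ^ 2) J).
  - apply rsum_monotone; [|lia].
    intros i; rewrite Rmult_comm; now apply sqn_term_ge0.
  - right; apply rsum_ext; intros; ring.
Qed.

(* [w 0] is unconstrained but irrelevant, since coefficient 0 vanishes. *)
Definition inv_weight (w : nat -> R) (n : nat) : R :=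
  match n with O => 0 | _ => / w n end.

Lemma inv_weight_ge0 (w : nat -> R) (n : nat) :
  (forall n, (1 <= n)%nat -> 0 < w n) -> 0 <= inv_weight w n.
Proof.
  intros Hw; destruct n; simpl; [lra|].
  left; apply Rinv_0_lt_compat, Hw; lia.
Qed.

Lemma inv_weight_term (w : nat -> R) (c : coef) (n : nat) :
  from3 c -> Cmod (c n) ^ 2 / w n = Cmod (c n) ^ 2 * inv_weight w n.
Proof.
  intros Hc; destruct n; [|reflexivity].
  rewrite Hc by lia; rewrite Cmod_0; unfold Rdiv; ring.
Qed.

Lemma linear_growth_holomorphic (c : coef) (B r : R) :
  (forall n, Cmod (c n) <= B * (INR n + 1)) -> 0 <= r < 1 ->
  ex_series (fun n => Cmod (c n) * r ^ n).
Proof.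
  intros Hc Hr.
  assert (HB : 0 <= B).
  { specialize (Hc 0%nat); simpl in Hc; assert (H := Cmod_ge_0 (c 0%nat)); lra. }
  apply (@ex_series_le R_AbsRing R_CompleteNormedModule)
    with (b := fun n => B * ((INR n + 1) * r ^ n)).
  - intros n.
    assert (0 <= r ^ n) by (apply pow_le; lra).
    change (Rabs (Cmod (c n) * r ^ n) <= B * ((INR n + 1) * r ^ n)).
    rewrite Rabs_pos_eq by (apply Rmult_le_pos; [apply Cmod_ge_0|assumption]).
    rewrite <- Rmult_assoc; apply Rmult_le_compat_r; auto.
  - apply (@ex_series_scal R_AbsRing R_NormedModule).
    assert (H : ex_pseries (PS_derive (fun _ => 1)) r).
    { apply CV_radius_inside; rewrite CV_radius_derive.
      apply Rbar_lt_le_trans with 1.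
      - simpl; rewrite Rabs_pos_eq; lra.
      - rewrite (CV_radius_finite_DAlembert _ 1);
          [simpl; lra|intros; lra|lra|].
        apply is_lim_seq_ext with (fun _ => 1); [|apply is_lim_seq_const].
        intros n; unfold Rdiv; rewrite Rinv_1, Rmult_1_l, Rabs_R1; reflexivity. }
    apply ex_pseries_R in H.
    apply ex_series_ext with (2 := H); intros n; unfold PS_derive.
    match goal with |- ?a = ?b => change ((a : R) = (b : R)) end.
    rewrite S_INR; ring.
Qed.

Lemma inX_intro (w : nat -> R) (c : coef) (B M : R) :
  (forall n, (1 <= n)%nat -> 0 < w n) -> from3 c ->
  (forall n, Cmod (c n) <= B * (INR n + 1)) ->
  (forall J, sqn (inv_weight w) c J <= M) -> inX w c.
Proof.
  intros Hw Hc HB HM; split; [exact Hc|]; split.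
  - intros r Hr; now apply linear_growth_holomorphic with B.
  - apply ex_series_ext with (fun n => Cmod (c n) ^ 2 * inv_weight w n).
    + intros n; symmetry; now apply inv_weight_term.
    + apply bounded_ex_series with M; [|exact HM].
      intros n; apply sqn_term_ge0; now apply inv_weight_ge0.
Qed.

Lemma xnorm_le (w : nat -> R) (c : coef) (M : R) :
  (forall n, (1 <= n)%nat -> 0 < w n) -> from3 c ->
  (forall J, sqn (inv_weight w) c J <= M) -> xnorm w c <= sqrt M.
Proof.
  intros Hw Hc HM; apply sqrt_le_1_alt.
  rewrite (Series_ext _ (fun n => Cmod (c n) ^ 2 * inv_weight w n))
    by (intros; now apply inv_weight_term).
  apply bounded_ex_series; [|exact HM].
  intros n; apply sqn_term_ge0; now apply inv_weight_ge0.
Qed.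

Lemma inX_sqn (w : nat -> R) (c : coef) :
  (forall n, (1 <= n)%nat -> 0 < w n) -> inX w c ->
  forall J, sqn (inv_weight w) c J <= xnorm w c ^ 2.
Proof.
  intros Hw [Hc [_ Hex]] J; unfold xnorm.
  assert (Heq : forall n, Cmod (c n) ^ 2 / w n = Cmod (c n) ^ 2 * inv_weight w n)
    by (intros; now apply inv_weight_term).
  assert (Hpos : forall n, 0 <= Cmod (c n) ^ 2 * inv_weight w n)
    by (intros; apply sqn_term_ge0; now apply inv_weight_ge0).
  apply (ex_series_ext _ _ Heq) in Hex.
  rewrite (Series_ext _ _ Heq).
  assert (H := fun n => rsum_le_Series _ n Hpos Hex).
  rewrite pow2_sqrt; [apply H|exact (H 0%nat)].
Qed.

(** * Separated sets of positive lower density *)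

Fixpoint val2_pos (p : positive) : nat :=
  match p with xO q => S (val2_pos q) | _ => 0%nat end.

Definition val2 (n : nat) : nat :=
  match N.of_nat n with N0 => 0%nat | Npos p => val2_pos p end.

Lemma val2_double (n : nat) : (1 <= n)%nat -> val2 (2 * n) = S (val2 n).
Proof.
  intros Hn; unfold val2; rewrite Nat2N.inj_double.
  destruct (N.of_nat n) eqn:E; [lia|reflexivity].
Qed.

Lemma val2_odd (n : nat) : val2 (2 * n + 1) = 0%nat.
Proof.
  unfold val2; replace (2 * n + 1)%nat with (S (2 * n)) by lia.
  rewrite Nat2N.inj_succ_double; now destruct (N.of_nat n).
Qed.

Lemma val2_pow2_odd (a q : nat) : val2 (2 ^ a * (2 * q + 1)) = a.
Proof.
  induction a as [|a IH].
  - now rewrite Nat.mul_1_l, val2_odd.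
  - replace (2 ^ S a * (2 * q + 1))%nat with (2 * (2 ^ a * (2 * q + 1)))%nat by (simpl; lia).
    rewrite val2_double; [now rewrite IH|].
    assert (2 ^ a <> 0)%nat by (apply Nat.pow_nonzero; lia); nia.
Qed.

(* Consecutive values are separated by more than the 2-adic valuations of both
   arguments; since these are 1 on average, growth is still linear. *)
Fixpoint spread (m : nat) : nat :=
  match m with
  | O => 0
  | S k => spread k + val2 k + val2 (S k) + 1
  end.

Lemma spread_lt (m m' : nat) :
  (m < m')%nat -> (spread m + val2 m < spread m' /\ spread m + val2 m' < spread m')%nat.
Proof.
  induction 1 as [|m' Hm IH]; simpl; lia.
Qed.

Lemma spread_inj (m m' : nat) : spread m = spread m' -> m = m'.
Proof.
  intros H; destruct (Nat.lt_total m m') as [h|[h|h]]; auto;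
    apply spread_lt in h; lia.
Qed.

Lemma spread_double (m : nat) : (spread (2 * m) <= spread m + 3 * m)%nat.
Proof.
  induction m as [|m IH]; [simpl; lia|].
  replace (2 * S m)%nat with (S (S (2 * m))) by lia; cbn [spread].
  replace (S (2 * m)) with (2 * m + 1)%nat by lia.
  replace (S (2 * m + 1)) with (2 * S m)%nat by lia.
  rewrite val2_odd, (val2_double (S m)) by lia.
  destruct m as [|m]; [simpl in *; lia|].
  rewrite (val2_double (S m)) by lia; lia.
Qed.

Lemma spread_le (m : nat) : (spread m <= 6 * m)%nat.
Proof.
  induction m as [m IH] using (well_founded_induction lt_wf).
  destruct (Nat.Even_or_Odd m) as [[k ->]|[k ->]].
  - destruct k as [|k]; [simpl; lia|].
    assert (H := spread_double (S k)); assert (H' := IH (S k)); lia.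
  - destruct k as [|k]; [cbv; lia|].
    assert (H := spread_double (S (S k))); assert (H' := IH (S (S k))).
    assert (H2 := spread_lt (2 * S k + 1) (2 * S (S k))); lia.
Qed.

Definition hits (a n : nat) : Prop :=
  exists q, n = spread (2 ^ a * (2 * q + 1)).

Lemma hits_ge (a n : nat) : hits a n -> (a <= n)%nat.
Proof.
  intros [q ->].
  assert (2 ^ a <> 0)%nat by (apply Nat.pow_nonzero; lia).
  assert (H' := spread_lt 0 (2 ^ a * (2 * q + 1))).
  rewrite val2_pow2_odd in H'; nia.
Qed.

Lemma hits_disjoint (a b n : nat) : hits a n -> hits b n -> a = b.
Proof.
  intros [q ->] [q' H]; apply spread_inj in H.
  now rewrite <- (val2_pow2_odd a q), H, val2_pow2_odd.
Qed.

Lemma hits_separated (a b m n : nat) :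
  hits a m -> hits b n -> (m < n)%nat -> (m + a < n /\ m + b < n)%nat.
Proof.
  intros [q ->] [q' ->] Hlt.
  destruct (Nat.lt_total (2 ^ a * (2 * q + 1)) (2 ^ b * (2 * q' + 1))) as [h|[h|h]].
  - apply spread_lt in h; rewrite !val2_pow2_odd in h; lia.
  - rewrite h in Hlt; lia.
  - apply spread_lt in h; lia.
Qed.

Lemma count_upto_S (P : nat -> Prop) (N : nat) :
  count_upto P (S N) =
  count_upto P N + if excluded_middle_informative (P (S N)) then 1 else 0.
Proof. reflexivity. Qed.

Lemma count_upto_ge0 (P : nat -> Prop) (N : nat) : 0 <= count_upto P N.
Proof.
  induction N as [|N IH]; [simpl|rewrite count_upto_S];
    destruct excluded_middle_informative; lra.
Qed.

Lemma count_upto_incr (P : nat -> Prop) (M N : nat) :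
  (M <= N)%nat -> count_upto P M <= count_upto P N.
Proof.
  induction 1 as [|N _ IH]; [lra|].
  rewrite count_upto_S; destruct excluded_middle_informative; lra.
Qed.

Lemma count_upto_incr_lt (P : nat -> Prop) (M N : nat) :
  (M < N)%nat -> P N -> count_upto P M + 1 <= count_upto P N.
Proof.
  intros HMN HP; destruct N as [|N]; [lia|].
  assert (H := count_upto_incr P M N ltac:(lia)).
  rewrite count_upto_S; destruct excluded_middle_informative; [lra|contradiction].
Qed.

Lemma count_upto_subset (P Q : nat -> Prop) (N : nat) :
  (forall n, P n -> Q n) -> count_upto P N <= count_upto Q N.
Proof.
  intros H; induction N as [|N IH]; [simpl|rewrite !count_upto_S];
    repeat destruct excluded_middle_informative; try lra; exfalso; auto.
Qed.

Lemma count_hits_spread (a q : nat) :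
  INR (q + 1) <= count_upto (hits a) (spread (2 ^ a * (2 * q + 1))).
Proof.
  assert (2 ^ a <> 0)%nat by (apply Nat.pow_nonzero; lia).
  induction q as [|q IH].
  - assert (H' := spread_lt 0 (2 ^ a * (2 * 0 + 1))).
    eapply Rle_trans; [|apply (count_upto_incr_lt _ 0); [nia|now exists 0%nat]].
    assert (H0 := count_upto_ge0 (hits a) 0); simpl (INR _); lra.
  - eapply Rle_trans;
      [|apply (count_upto_incr_lt _ (spread (2 ^ a * (2 * q + 1)))); [|now exists (S q)]].
    + replace (S q + 1)%nat with (S (q + 1)) by lia; rewrite S_INR; lra.
    + assert (H' := spread_lt (2 ^ a * (2 * q + 1)) (2 ^ a * (2 * S q + 1))); nia.
Qed.

Lemma count_hits_linear (a N : nat) :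
  (12 * 2 ^ a <= N)%nat ->
  / (2 * INR (12 * 2 ^ a)) <= count_upto (hits a) N / INR (N + 1).
Proof.
  set (D := (12 * 2 ^ a)%nat); intros HN.
  assert (HD : (0 < D)%nat).
  { assert (2 ^ a <> 0)%nat by (apply Nat.pow_nonzero; lia); unfold D; lia. }
  assert (Hdiv := Nat.div_mod_eq N D).
  assert (Hmod := Nat.mod_upper_bound N D ltac:(lia)).
  assert (Hq : (1 <= N / D)%nat) by (apply Nat.div_le_lower_bound; lia).
  destruct (N / D)%nat as [|q]; [lia|].
  assert (Hc : INR (q + 1) <= count_upto (hits a) N).
  { eapply Rle_trans; [apply count_hits_spread|apply count_upto_incr].
    eapply Nat.le_trans; [apply spread_le|]; unfold D in *; nia. }
  assert (HR : INR (N + 1) <= 2 * INR D * INR (q + 1)).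
  { replace 2 with (INR 2) by reflexivity; rewrite <- !mult_INR; apply le_INR; nia. }
  assert (0 < INR D) by (apply lt_0_INR; lia).
  assert (0 < INR (N + 1)) by (apply lt_0_INR; lia).
  apply Rmult_le_reg_r with (INR (N + 1)); [assumption|].
  unfold Rdiv; rewrite Rmult_assoc, Rinv_l, Rmult_1_r by lra.
  apply Rmult_le_reg_l with (2 * INR D); [lra|].
  rewrite <- Rmult_assoc, Rinv_r, Rmult_1_l by lra; nra.
Qed.

Lemma LimInf_count_pos (P : nat -> Prop) (a : nat) :
  (forall n, hits a n -> P n) ->
  Rbar_lt (Finite 0) (LimInf_seq (fun N => count_upto P N / INR (N + 1))).
Proof.
  intros H.
  assert (2 ^ a <> 0)%nat by (apply Nat.pow_nonzero; lia).
  apply Rbar_lt_le_trans with (Finite (/ (2 * INR (12 * 2 ^ a)))).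
  - simpl; apply Rinv_0_lt_compat, Rmult_lt_0_compat; [lra|apply lt_0_INR; lia].
  - rewrite <- LimInf_seq_const; apply LimInf_le.
    exists (12 * 2 ^ a)%nat; intros N HN.
    eapply Rle_trans; [apply count_hits_linear; exact HN|].
    apply Rmult_le_compat_r; [|now apply count_upto_subset].
    left; apply Rinv_0_lt_compat, lt_0_INR; lia.
Qed.

(** * A countable dense set of vectors killed by powers of the operator *)

Lemma choice_fun (A B : Type) (P : A -> B -> Prop) :
  (forall a, exists b, P a b) -> exists f, forall a, P a (f a).
Proof.
  intros H; exists (fun a => proj1_sig (constructive_indefinite_description _ (H a))).
  intros a; apply proj2_sig.
Qed.

Definition mono (z : C) (m : nat) : coef := fun n => if (n =? m)%nat then z else 0%C.

Lemma mono_neq (z : C) (m n : nat) : n <> m -> mono z m n = 0%C.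
Proof. intros H; unfold mono; now rewrite (proj2 (Nat.eqb_neq n m) H). Qed.

Lemma mono_0 (m : nat) : mono 0%C m = czero.
Proof. apply functional_extensionality; intros n; unfold mono; now destruct (n =? m)%nat. Qed.

Lemma mono_from3 (z : C) (m : nat) : (3 <= m)%nat -> from3 (mono z m).
Proof. intros Hm n Hn; apply mono_neq; lia. Qed.

Lemma dbl_mono (z : C) (m : nat) : dbl (mono z m) = mono z (2 * m).
Proof.
  apply functional_extensionality; intros n.
  destruct (Nat.Even_or_Odd n) as [[k ->]|[k ->]].
  - rewrite dbl_even; unfold mono.
    destruct (Nat.eqb_spec k m); destruct (Nat.eqb_spec (2 * k) (2 * m)); trivial; lia.
  - rewrite dbl_odd, mono_neq; [reflexivity|lia].
Qed.

Lemma Top_mono_even (z : C) (m : nat) : (3 <= m)%nat -> Top (mono z (2 * m)) = mono z m.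
Proof. intros Hm; rewrite <- dbl_mono; now apply Top_dbl, mono_from3. Qed.

Lemma Top_mono_odd (z : C) (m : nat) :
  (1 <= m)%nat -> Top (mono z (2 * m + 1)) = mono z (3 * m + 2).
Proof.
  intros Hm; apply functional_extensionality; intros k; rewrite Top_eq.
  destruct (Nat.ltb_spec k 3); [rewrite mono_neq; [reflexivity|lia]|].
  rewrite mono_neq by lia; rewrite Cplus_0_l; unfold odd_part, mono.
  assert (Hdiv := Nat.div_mod_eq k 3).
  assert (Hmod := Nat.mod_upper_bound k 3).
  destruct (Nat.eqb_spec (k mod 3) 2); destruct (Nat.eqb_spec k (3 * m + 2));
    destruct (Nat.eqb_spec (2 * (k / 3) + 1) (2 * m + 1)); trivial; lia.
Qed.

Lemma Top_mono_4 (z : C) : Top (mono z 4) = czero.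
Proof.
  apply functional_extensionality; intros k; rewrite Top_eq; unfold odd_part.
  destruct (Nat.ltb_spec k 3); [reflexivity|].
  rewrite !mono_neq by lia; rewrite Cplus_0_l; now destruct (k mod 3 =? 2)%nat.
Qed.

Definition cpair (z : C) (m n : nat) : coef := cadd (mono z m) (mono (- z)%C n).

Lemma cpair_diag (z : C) (m : nat) : cpair z m m = czero.
Proof.
  apply functional_extensionality; intros n; unfold cpair, cadd, mono, czero.
  destruct (n =? m)%nat; ring.
Qed.

(* An odd m has the same image as 3m + 1, and m |-> 2m transports such pairs. *)
Lemma companion_exists (m : nat) :
  (3 <= m)%nat ->
  exists n, (m < n)%nat /\ exists N, forall z, Nat.iter N Top (cpair z m n) = czero.
Proof.
  induction m as [m IH] using (well_founded_induction lt_wf); intros Hm.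
  destruct (Nat.Even_or_Odd m) as [[k ->]|[k ->]].
  - destruct (Nat.eq_dec k 2) as [->|Hk].
    + exists 8%nat; split; [lia|]; exists 2%nat; intros z.
      unfold cpair; rewrite iter_Top_add.
      change (cadd (Top (Top (mono z 4))) (Top (Top (mono (- z)%C (2 * 4)))) = czero).
      rewrite (Top_mono_even _ 4), !Top_mono_4, Top_0 by lia; apply cadd_0_l.
    + destruct (IH k) as [n [Hn [N HN]]]; try lia.
      exists (2 * n)%nat; split; [lia|]; exists (S N); intros z.
      rewrite Nat.iter_succ_r; unfold cpair.
      rewrite Top_add, !Top_mono_even by lia; apply HN.
  - exists (2 * (3 * k + 2))%nat; split; [lia|]; exists 1%nat; intros z.
    change (Top (cpair z (2 * k + 1) (2 * (3 * k + 2))) = czero).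
    unfold cpair; rewrite Top_add, Top_mono_odd, Top_mono_even by lia; apply cpair_diag.
Qed.

Definition rat_seq (n : nat) : R :=
  let (p, d) := Cantor.of_nat n in
  let (a, b) := Cantor.of_nat p in (INR a - INR b) / (INR d + 1).

Lemma rat_dense (x eps : R) : 0 < eps -> exists n, Rabs (rat_seq n - x) <= eps.
Proof.
  intros Heps.
  destruct (archimed_cor1 eps Heps) as [d [Hd Hd0]].
  assert (HD : 0 < INR d) by now apply lt_0_INR.
  set (z := up (x * INR d)).
  destruct (archimed (x * INR d)) as [Hz1 Hz2]; fold z in Hz1, Hz2.
  exists (Cantor.to_nat (Cantor.to_nat (Z.to_nat z, Z.to_nat (- z)), (d - 1)%nat)).
  unfold rat_seq; rewrite !Cantor.cancel_of_to.
  replace (INR (Z.to_nat z) - INR (Z.to_nat (- z))) with (IZR z).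
  2:{ rewrite !INR_IZR_INZ, <- minus_IZR; f_equal; lia. }
  rewrite minus_INR by lia; simpl (INR 1).
  replace (INR d - 1 + 1) with (INR d) by ring.
  replace (IZR z / INR d - x) with ((IZR z - x * INR d) * / INR d) by (field; lra).
  assert (Hi : 0 < / INR d) by now apply Rinv_0_lt_compat.
  rewrite Rabs_pos_eq by (apply Rmult_le_pos; lra).
  apply Rle_trans with (1 * / INR d); [apply Rmult_le_compat_r; lra|lra].
Qed.

Definition dense_C (n : nat) : C :=
  let (a, b) := Cantor.of_nat n in (rat_seq a, rat_seq b).

Lemma dense_C_dense (z : C) (eps : R) :
  0 < eps -> exists n, Cmod (Cminus (dense_C n) z) ^ 2 <= eps.
Proof.
  intros Heps.
  assert (Hs : 0 < sqrt (eps / 2)) by (apply sqrt_lt_R0; lra).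
  destruct (rat_dense (fst z) _ Hs) as [a Ha].
  destruct (rat_dense (snd z) _ Hs) as [b Hb].
  exists (Cantor.to_nat (a, b)); unfold dense_C; rewrite Cantor.cancel_of_to.
  assert (H2 : sqrt (eps / 2) ^ 2 = eps / 2) by (apply pow2_sqrt; lra).
  apply (pow_maj_Rabs _ _ 2) in Ha; apply (pow_maj_Rabs _ _ 2) in Hb.
  rewrite H2 in Ha, Hb.
  unfold Cmod; rewrite pow2_sqrt.
  - unfold Rminus in Ha, Hb; simpl fst; simpl snd; lra.
  - apply Rplus_le_le_0_compat; apply pow2_ge_0.
Qed.

Fixpoint decode_list (len s : nat) : list (nat * nat) :=
  match len with
  | O => nil
  | S k => let (a, t) := Cantor.of_nat s in Cantor.of_nat a :: decode_list k t
  end.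

Lemma decode_list_surj (l : list (nat * nat)) : exists s, decode_list (length l) s = l.
Proof.
  induction l as [|a l [s Hs]]; [now exists 0%nat|].
  exists (Cantor.to_nat (Cantor.to_nat a, s)); cbn [decode_list length].
  now rewrite !Cantor.cancel_of_to, Hs.
Qed.

Definition enum_list (s : nat) : list (nat * nat) :=
  let (_, t) := Cantor.of_nat s in
  let (len, r) := Cantor.of_nat t in decode_list len r.

Lemma enum_list_surj (l : list (nat * nat)) (L : nat) :
  exists s, (L <= s)%nat /\ enum_list s = l.
Proof.
  destruct (decode_list_surj l) as [r Hr].
  exists (Cantor.to_nat (L, Cantor.to_nat (length l, r))); split.
  - assert (H := Cantor.to_nat_non_decreasing L (Cantor.to_nat (length l, r))); lia.
  - unfold enum_list; now rewrite !Cantor.cancel_of_to.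
Qed.

Fixpoint comb (V : nat -> nat) (l : list (nat * nat)) : coef :=
  match l with
  | nil => czero
  | (k, m) :: l' => cadd (cpair (dense_C k) (m + 3) (V (m + 3)%nat)) (comb V l')
  end.

Lemma comb_app (V : nat -> nat) (l l' : list (nat * nat)) :
  comb V (l ++ l') = cadd (comb V l) (comb V l').
Proof.
  induction l as [|[k m] l IH]; simpl.
  - now rewrite cadd_0_l.
  - rewrite IH; apply functional_extensionality; intros n; unfold cadd; ring.
Qed.

Lemma comb_spec (V : nat -> nat) (l : list (nat * nat)) :
  (forall m, (3 <= m)%nat -> (m < V m)%nat /\
     exists N, forall z, Nat.iter N Top (cpair z m (V m)) = czero) ->
  from3 (comb V l) /\ (exists B, forall k, (B <= k)%nat -> comb V l k = 0%C) /\
  exists N, Nat.iter N Top (comb V l) = czero.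
Proof.
  intros HV; induction l as [|[k m] l [IH1 [[B IH2] [N IH3]]]]; simpl.
  - split; [easy|]; split; now exists 0%nat.
  - destruct (HV (m + 3)%nat) as [Hlt [N' HN']]; [lia|].
    split; [|split].
    + intros n Hn; unfold cadd, cpair, cadd.
      rewrite IH1, !mono_neq by lia; ring.
    + exists (B + V (m + 3) + 1)%nat; intros n Hn; unfold cadd, cpair, cadd.
      rewrite IH2, !mono_neq by lia; ring.
    + exists (Nat.max N N'); rewrite iter_Top_add.
      rewrite (iter_Top_stable _ N'), (iter_Top_stable _ N); auto; try lia.
      apply cadd_0_l.
Qed.

Lemma sqn_zero (v : nat -> R) (J : nat) : sqn v czero J = 0.
Proof.
  unfold sqn; rewrite (rsum_ext _ (fun _ => 0)); [apply rsum_0|].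
  intros i _; unfold czero; rewrite Cmod_0; ring.
Qed.

Lemma sqn_cadd_mono_le (v : nat -> R) (c : coef) (z : C) (m J : nat) :
  (forall n, 0 <= v n) -> c m = 0%C ->
  sqn v (cadd c (mono z m)) J <= sqn v c J + Cmod z ^ 2 * v m.
Proof.
  intros Hv Hc.
  assert (Hle : rsum (fun j => if (j =? m)%nat then Cmod z ^ 2 * v m else 0) J <=
                Cmod z ^ 2 * v m).
  { assert (H0 : 0 <= Cmod z ^ 2 * v m) by (apply Rmult_le_pos; [apply pow2_ge_0|auto]).
    assert (H : forall J, rsum (fun j => if (j =? m)%nat then Cmod z ^ 2 * v m else 0) J =
      if (m <? J)%nat then Cmod z ^ 2 * v m else 0).
    { induction J0 as [|K IH]; [reflexivity|]; cbn [rsum]; rewrite IH.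
      destruct (Nat.ltb_spec m K); destruct (Nat.ltb_spec m (S K));
        destruct (Nat.eqb_spec K m); try lia; ring. }
    rewrite H; destruct (m <? J)%nat; lra. }
  eapply Rle_trans; [|apply Rplus_le_compat_l, Hle].
  unfold sqn; rewrite <- rsum_plus; right; apply rsum_ext; intros j _; unfold cadd, mono.
  destruct (Nat.eqb_spec j m) as [->|].
  - rewrite Hc, Cplus_0_l, Cmod_0; ring.
  - rewrite Cplus_0_r; ring.
Qed.

Lemma sqn_mono_le (v : nat -> R) (z : C) (m J : nat) :
  (forall n, 0 <= v n) -> sqn v (mono z m) J <= Cmod z ^ 2 * v m.
Proof.
  intros Hv; rewrite <- (cadd_0_l (mono z m)).
  eapply Rle_trans; [now apply sqn_cadd_mono_le|]; rewrite sqn_zero; lra.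
Qed.

Definition approximable (v : nat -> R) (V : nat -> nat) (g : coef) : Prop :=
  forall eps, 0 < eps -> exists l, forall J, sqn v (csub (comb V l) g) J <= eps.

Lemma approx_0 (v : nat -> R) (V : nat -> nat) : approximable v V czero.
Proof.
  intros eps Heps; exists nil; intros J; simpl.
  replace (csub czero czero) with czero; [rewrite sqn_zero; lra|].
  apply functional_extensionality; intros n; unfold csub, czero; ring.
Qed.

Lemma approx_add (v : nat -> R) (V : nat -> nat) (g h : coef) :
  (forall n, 0 <= v n) -> approximable v V g -> approximable v V h ->
  approximable v V (cadd g h).
Proof.
  intros Hv Hg Hh eps Heps.
  destruct (Hg (eps / 4)) as [l Hl]; [lra|].
  destruct (Hh (eps / 4)) as [l' Hl']; [lra|].
  exists (l ++ l')%list; intros J; rewrite comb_app.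
  replace (csub (cadd (comb V l) (comb V l')) (cadd g h))
    with (cadd (csub (comb V l) g) (csub (comb V l') h)).
  - eapply Rle_trans; [now apply sqn_add_le|]; specialize (Hl J); specialize (Hl' J); lra.
  - apply functional_extensionality; intros n; unfold csub, cadd; ring.
Qed.

Lemma approx_limit (v : nat -> R) (V : nat -> nat) (g : coef) :
  (forall n, 0 <= v n) ->
  (forall eps, 0 < eps ->
     exists h, approximable v V h /\ forall J, sqn v (csub h g) J <= eps) ->
  approximable v V g.
Proof.
  intros Hv H eps Heps.
  destruct (H (eps / 4)) as [h [Hh Hhg]]; [lra|].
  destruct (Hh (eps / 4)) as [l Hl]; [lra|].
  exists l; intros J.
  replace (csub (comb V l) g) with (cadd (csub (comb V l) h) (csub h g)).
  - eapply Rle_trans; [now apply sqn_add_le|]; specialize (Hl J); specialize (Hhg J); lra.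
  - apply functional_extensionality; intros n; unfold csub, cadd; ring.
Qed.

Lemma approx_companion (v : nat -> R) (V : nat -> nat) (b : R) (z : C) (m : nat) :
  (forall n, 0 <= v n <= b) -> (3 <= m)%nat -> approximable v V (cpair z m (V m)).
Proof.
  intros Hv Hm eps Heps.
  assert (Hv0 : forall n, 0 <= v n) by (intros; apply Hv).
  assert (Hb : 0 <= b) by (destruct (Hv 0%nat); lra).
  destruct (dense_C_dense z (eps / (4 * (b + 1)))) as [k Hk].
  { apply Rdiv_lt_0_compat; lra. }
  exists ((k, m - 3)%nat :: nil); intros J; simpl.
  replace (m - 3 + 3)%nat with m by lia.
  set (y := Cminus (dense_C k) z) in *.
  replace (csub _ _) with (cadd (mono y m) (mono (- y)%C (V m))).
  - eapply Rle_trans; [now apply sqn_add_le|].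
    assert (H1 := sqn_mono_le v y m J Hv0).
    assert (H2 := sqn_mono_le v (- y)%C (V m) J Hv0).
    rewrite Cmod_opp in H2.
    assert (Hy := pow2_ge_0 (Cmod y)).
    assert (Cmod y ^ 2 * v m <= Cmod y ^ 2 * (b + 1)).
    { apply Rmult_le_compat_l; [exact Hy|destruct (Hv m); lra]. }
    assert (Cmod y ^ 2 * v (V m) <= Cmod y ^ 2 * (b + 1)).
    { apply Rmult_le_compat_l; [exact Hy|destruct (Hv (V m)); lra]. }
    assert (Cmod y ^ 2 * (b + 1) <= eps / 4); [|lra].
    apply (Rmult_le_compat_r (b + 1)) in Hk; [|lra].
    replace (eps / 4) with (eps / (4 * (b + 1)) * (b + 1)) by (field; lra).
    exact Hk.
  - apply functional_extensionality; intros n; unfold csub, cadd, cpair, cadd, mono, czero, y.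
    destruct (n =? m)%nat, (n =? V m)%nat; ring.
Qed.

Lemma iter_gt (V : nat -> nat) (m j : nat) :
  (forall m, (3 <= m)%nat -> (m < V m)%nat) -> (3 <= m)%nat ->
  (3 <= Nat.iter j V m)%nat /\ (Nat.iter j V m < Nat.iter (S j) V m)%nat.
Proof.
  intros HV Hm; induction j as [|j [IH1 IH2]].
  - split; [exact Hm|now apply HV].
  - assert (3 <= Nat.iter (S j) V m)%nat by lia.
    split; [assumption|]; now apply (HV (Nat.iter (S j) V m)).
Qed.

Lemma approx_iterated_companion
    (v : nat -> R) (V : nat -> nat) (b : R) (z : C) (m j : nat) :
  (forall n, 0 <= v n <= b) -> (forall m, (3 <= m)%nat -> (m < V m)%nat) ->
  (3 <= m)%nat -> approximable v V (cpair z m (Nat.iter j V m)).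
Proof.
  intros Hv HV Hm; induction j as [|j IH].
  - simpl; rewrite cpair_diag; apply approx_0.
  - replace (cpair z m (Nat.iter (S j) V m))
      with (cadd (cpair z m (Nat.iter j V m))
                 (cpair z (Nat.iter j V m) (V (Nat.iter j V m)))).
    + apply approx_add; [intros; apply Hv|exact IH|].
      apply approx_companion with b; [exact Hv|now apply iter_gt].
    + apply functional_extensionality; intros n; unfold cpair, cadd, mono; simpl Nat.iter.
      destruct (n =? Nat.iter j V m)%nat; ring.
Qed.

(* Averaging the companions spreads the error over J monomials, whose norms are
   bounded because the weight is bounded from below. *)
Lemma approx_mono (v : nat -> R) (V : nat -> nat) (b : R) (z : C) (m : nat) :
  (forall n, 0 <= v n <= b) -> (forall m, (3 <= m)%nat -> (m < V m)%nat) ->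
  (3 <= m)%nat -> approximable v V (mono z m).
Proof.
  intros Hv HV Hm.
  assert (Hv0 : forall n, 0 <= v n) by (intros; apply Hv).
  assert (Hb : 0 <= b) by (destruct (Hv 0%nat); lra).
  apply approx_limit; [exact Hv0|]; intros eps Heps.
  assert (Hz := pow2_ge_0 (Cmod z)).
  destruct (archimed_cor1 (eps / (Cmod z ^ 2 * b + 1))) as [N [HN HN0]].
  { apply Rdiv_lt_0_compat; [lra|nra]. }
  assert (HNR : 0 < INR N) by now apply lt_0_INR.
  set (y := (RtoC (/ INR N) * z)%C).
  assert (H : forall j, exists r,
    approximable v V (cadd (mono (RtoC (INR j) * y)%C m) r) /\
    (forall n, (Nat.iter j V m < n)%nat -> r n = 0%C) /\
    forall J, sqn v r J <= INR j * (Cmod y ^ 2 * b)).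
  { induction j as [|j [r [Hr1 [Hr2 Hr3]]]].
    - exists czero; split; [|split; [reflexivity|]].
      + simpl (INR 0); rewrite Cmult_0_l, mono_0, cadd_0_l; apply approx_0.
      + intros J; rewrite sqn_zero; simpl; lra.
    - destruct (iter_gt V m j HV Hm) as [_ Hlt].
      exists (cadd r (mono (- y)%C (Nat.iter (S j) V m))); split; [|split].
      + replace (cadd _ _) with
          (cadd (cadd (mono (RtoC (INR j) * y)%C m) r) (cpair y m (Nat.iter (S j) V m))).
        * apply approx_add; [exact Hv0|exact Hr1|].
          now apply approx_iterated_companion with b.
        * apply functional_extensionality; intros n; unfold cpair, cadd.
          rewrite S_INR, RtoC_plus; unfold mono.
          destruct (n =? m)%nat; ring.
      + intros n Hn; unfold cadd; rewrite Hr2, mono_neq by lia; apply Cplus_0_l.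
      + intros J; eapply Rle_trans.
        * apply sqn_cadd_mono_le; [exact Hv0|apply Hr2; exact Hlt].
        * rewrite Cmod_opp, S_INR; specialize (Hr3 J).
          assert (Cmod y ^ 2 * v (Nat.iter (S j) V m) <= Cmod y ^ 2 * b).
          { apply Rmult_le_compat_l; [apply pow2_ge_0|apply Hv]. }
          lra. }
  destruct (H N) as [r [Hr1 [_ Hr3]]].
  exists (cadd (mono z m) r).
  replace (RtoC (INR N) * y)%C with z in Hr1.
  2:{ unfold y; rewrite Cmult_assoc, <- RtoC_mult, Rinv_r by lra; ring. }
  split; [exact Hr1|]; intros J.
  replace (csub (cadd (mono z m) r) (mono z m)) with r.
  2:{ apply functional_extensionality; intros n; unfold csub, cadd; ring. }
  eapply Rle_trans; [apply Hr3|].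
  unfold y; rewrite Cmod_mult, Cmod_R, Rabs_pos_eq by (left; now apply Rinv_0_lt_compat).
  replace (INR N * ((/ INR N * Cmod z) ^ 2 * b)) with (/ INR N * (Cmod z ^ 2 * b))
    by (field; lra).
  apply Rle_trans with (eps / (Cmod z ^ 2 * b + 1) * (Cmod z ^ 2 * b + 1)).
  - apply Rmult_le_compat; try lra; [left; now apply Rinv_0_lt_compat|nra].
  - right; field; nra.
Qed.

Lemma approx_all (v : nat -> R) (V : nat -> nat) (b M : R) (g : coef) :
  (forall n, 0 <= v n <= b) -> (forall m, (3 <= m)%nat -> (m < V m)%nat) ->
  from3 g -> (forall J, sqn v g J <= M) -> approximable v V g.
Proof.
  intros Hv HV Hg HM.
  assert (Hv0 : forall n, 0 <= v n) by (intros; apply Hv).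
  set (trunc := fun B n => if (n <? B)%nat then g n else 0%C).
  assert (Htr : forall B, approximable v V (trunc B)).
  { induction B as [|B IH].
    - apply approx_0.
    - replace (trunc (S B)) with (cadd (trunc B) (mono (g B) B)).
      + apply approx_add; [exact Hv0|exact IH|].
        destruct (Nat.lt_ge_cases B 3) as [h|h].
        * rewrite Hg, mono_0 by exact h; apply approx_0.
        * now apply approx_mono with b.
      + apply functional_extensionality; intros n; unfold cadd, trunc, mono.
        destruct (Nat.ltb_spec n B); destruct (Nat.ltb_spec n (S B));
          destruct (Nat.eqb_spec n B); subst; try lia; ring. }
  apply approx_limit; [exact Hv0|]; intros eps Heps.
  destruct (rsum_tail_small (fun j => Cmod (g j) ^ 2 * v j) M) with (eps := eps) as [L HL].
  - intros n; now apply sqn_term_ge0.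
  - exact HM.
  - exact Heps.
  - exists (trunc L); split; [apply Htr|]; intros J.
    eapply Rle_trans; [|apply (HL L J (le_n L))].
    right; apply rsum_ext; intros j _; unfold csub, trunc.
    destruct (Nat.ltb_spec j L); destruct (Nat.leb_spec L j); try lia.
    + replace (Cminus (g j) (g j)) with (RtoC 0) by ring; rewrite Cmod_0; ring.
    + replace (Cminus 0%C (g j)) with (- g j)%C by ring; now rewrite Cmod_opp.
Qed.

Lemma dense_killed_sequence (v : nat -> R) (b : R) :
  (forall n, 0 <= v n <= b) ->
  exists p : nat -> coef,
    (forall s, from3 (p s) /\ (exists B, forall k, (B <= k)%nat -> p s k = 0%C) /\
       exists N, Nat.iter N Top (p s) = czero) /\
    forall g M, from3 g -> (forall J, sqn v g J <= M) ->
      forall eps L, 0 < eps ->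
        exists s, (L <= s)%nat /\ forall J, sqn v (csub (p s) g) J <= eps.
Proof.
  intros Hv.
  destruct (choice_fun nat nat (fun m n => (3 <= m)%nat -> (m < n)%nat /\
    exists N, forall z, Nat.iter N Top (cpair z m n) = czero)) as [V HV].
  { intros m; destruct (Nat.lt_ge_cases m 3) as [h|h].
    - exists 0%nat; lia.
    - destruct (companion_exists m h) as [n Hn]; now exists n. }
  exists (fun s => comb V (enum_list s)); split.
  - intros s; now apply comb_spec.
  - intros g M Hg HM eps L Heps.
    destruct (approx_all v V b M g) with (eps := eps) as [l Hl]; auto.
    { intros m Hm; now apply HV. }
    destruct (enum_list_surj l L) as [s [Hs <-]]; now exists s.
Qed.

(** * Frequent hypercyclicity *)

Lemma strict_thresholds (good : nat -> nat -> Prop) :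
  (forall s, exists b, forall n, (b <= n)%nat -> good s n) ->
  exists a : nat -> nat, (forall s t, (s < t)%nat -> (a s < a t)%nat) /\
    (forall s, (s <= a s)%nat) /\ forall s n, (a s <= n)%nat -> good s n.
Proof.
  intros H; destruct (choice_fun _ _ _ H) as [b Hb].
  set (a := fix a s := match s with O => b 0%nat | S t => (S (a t) + b s)%nat end).
  exists a; split; [|split].
  - induction 1; cbn; lia.
  - induction s as [|s IH]; cbn; lia.
  - intros [|s] n Hn; apply Hb; cbn in Hn; lia.
Qed.

Lemma energy_bounded (w : nat -> R) (c : coef) (B : nat) :
  (forall n, (1 <= n)%nat -> 0 < w n) ->
  (forall k, (3 <= k)%nat -> ex_series (fun n => / w (k * 2 ^ n)%nat)) ->
  from3 c ->
  exists M, forall N,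
    rsum (fun n => sqn (fun k => inv_weight w (k * 2 ^ n)) c B) N <= M.
Proof.
  intros Hw Hser Hc; induction B as [|B [M HM]].
  - exists 0; intros N; unfold sqn; cbn [rsum]; rewrite rsum_0; lra.
  - exists (M + Cmod (c B) ^ 2 * Series (fun n => inv_weight w (B * 2 ^ n))); intros N.
    unfold sqn; cbn [rsum]; rewrite rsum_plus, rsum_scal.
    apply Rplus_le_compat; [apply HM|].
    destruct (Nat.lt_ge_cases B 3) as [h|h].
    + rewrite Hc, Cmod_0 by exact h; lra.
    + apply Rmult_le_compat_l; [apply pow2_ge_0|].
      apply rsum_le_Series; [intros; now apply inv_weight_ge0|].
      apply ex_series_ext with (2 := Hser B h); intros n.
      destruct (B * 2 ^ n)%nat eqn:E; [|reflexivity].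
      assert (2 ^ n <> 0)%nat by (apply Nat.pow_nonzero; lia); nia.
Qed.

Lemma rsum_half_pow (N : nat) : rsum (fun s => (1 / 2) ^ s) N <= 2.
Proof.
  assert (H : rsum (fun s => (1 / 2) ^ s) N = 2 - 2 * (1 / 2) ^ N).
  { induction N as [|N IH]; cbn [rsum pow]; [lra|rewrite IH; lra]. }
  assert (0 < (1 / 2) ^ N) by (apply pow_lt; lra); lra.
Qed.

Lemma finite_support_bounded (c : coef) (B : nat) :
  (forall k, (B <= k)%nat -> c k = 0%C) ->
  forall k, Cmod (c k) <= rsum (fun k => Cmod (c k)) B.
Proof.
  intros Hc k; destruct (Nat.lt_ge_cases k B) as [h|h].
  - apply (rsum_term_le (fun k => Cmod (c k))); [intros; apply Cmod_ge_0|exact h].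
  - rewrite Hc, Cmod_0 by exact h; apply rsum_ge0; intros; apply Cmod_ge_0.
Qed.

Lemma orbit_hits_open (w : nat -> R) (f g : coef) (U : coef -> Prop) (a : nat) :
  (forall n, (1 <= n)%nat -> 0 < w n) ->
  (forall h, inX w h -> inX w (Top h)) -> inX w f -> inX w g ->
  forall eps, 0 < eps -> (forall h, inX w h -> xnorm w (csub h g) < eps -> U h) ->
  (forall n J, hits a n ->
     sqn (inv_weight w) (csub (Nat.iter n Top f) g) J <= eps ^ 2 / 2) ->
  Rbar_lt (Finite 0)
    (LimInf_seq (fun N => count_upto (fun n => U (Nat.iter n Top f)) N / INR (N + 1))).
Proof.
  intros Hw HT Hf Hg eps Heps HU Hclose; apply LimInf_count_pos with a; intros n Hn.
  assert (Hin : inX w (Nat.iter n Top f)).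
  { clear Hn; induction n as [|n IH]; [exact Hf|exact (HT _ IH)]. }
  apply HU; [exact Hin|].
  apply Rle_lt_trans with (sqrt (eps ^ 2 / 2)).
  - apply xnorm_le; [exact Hw| |intros J; now apply Hclose].
    intros j Hj; unfold csub; rewrite (proj1 Hin), (proj1 Hg) by exact Hj; ring.
  - rewrite <- (sqrt_pow2 eps) at 2 by lra.
    assert (0 < eps ^ 2) by (apply pow_lt; lra).
    apply sqrt_lt_1_alt; lra.
Qed.

Lemma frequently_hypercyclic_of_summable (w : nat -> R) :
  (forall n, (1 <= n)%nat -> 0 < w n) ->
  (exists d, 0 < d /\ forall n, (1 <= n)%nat -> d <= w n) ->
  (forall k, (3 <= k)%nat -> ex_series (fun n => / w (k * 2 ^ n)%nat)) ->
  (forall h, inX w h -> inX w (Top h)) ->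
  frequently_hypercyclic w.
Proof.
  intros Hw [d [Hd Hdw]] Hser HT.
  set (v := inv_weight w).
  assert (Hv0 : forall n, 0 <= v n) by (intros; now apply inv_weight_ge0).
  assert (Hv : forall n, 0 <= v n <= / d).
  { intros n; split; [apply Hv0|]; destruct n as [|n].
    - left; now apply Rinv_0_lt_compat.
    - apply Rinv_le_contravar; [exact Hd|apply Hdw; lia]. }
  destruct (dense_killed_sequence v (/ d) Hv) as [p [Hp Hdense]].
  destruct (choice_fun nat nat _ (fun s => proj1 (proj2 (Hp s)))) as [B HB].
  set (E := fun s n => sqn (fun k => v (k * 2 ^ n)%nat) (p s) (B s)).
  assert (HE0 : forall s n, 0 <= E s n).
  { intros s n; apply rsum_ge0; intros k _.
    apply (sqn_term_ge0 (fun k => v (k * 2 ^ n)%nat)), Hv0. }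
  assert (HE : forall s n J, sqn v (Nat.iter n dbl (p s)) J <= E s n).
  { intros s n J; apply sqn_iter_dbl_le; [exact Hv0|apply HB]. }
  destruct (strict_thresholds (fun s n =>
      (forall k, p s k <> 0%C -> (k < 2 ^ n)%nat) /\
      (forall k, Cmod (p s k) <= INR n) /\
      Nat.iter n Top (p s) = czero /\
      forall J, rsum (fun i => if (n <=? i)%nat then E s i else 0) J <= (1 / 2) ^ s))
    as [a [Hainj [Hage Ha]]].
  { intros s; destruct (Hp s) as [Hp3 [_ [N HN]]].
    destruct (INR_unbounded (rsum (fun k => Cmod (p s k)) (B s))) as [b Hb].
    destruct (energy_bounded w (p s) (B s) Hw Hser Hp3) as [M HM].
    destruct (rsum_tail_small (E s) M (HE0 s) HM ((1 / 2) ^ s)) as [L HL];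
      [apply pow_lt; lra|].
    exists (B s + N + b + L)%nat; intros n Hn; split; [|split; [|split]].
    - intros k Hk; apply Nat.lt_trans with (B s).
      + apply Nat.nle_gt; intros h; now apply Hk, HB.
      + apply Nat.le_lt_trans with n; [lia|apply Nat.pow_gt_lin_r; lia].
    - intros k; eapply Rle_trans; [apply finite_support_bounded, HB|].
      apply Rle_trans with (INR b); [lra|apply le_INR; lia].
    - apply iter_Top_stable with N; [lia|exact HN].
    - intros J; apply HL; lia. }
  destruct (choice_fun nat coef (fun n c =>
      (forall s, hits (a s) n -> c = p s) /\
      (c = czero \/ exists s, hits (a s) n))) as [x Hx].
  { intros n; destruct (excluded_middle_informative (exists s, hits (a s) n)) as [[s Hs]|Hn].
    - exists (p s); split; [|right; now exists s].
      intros t Ht; assert (h := hits_disjoint _ _ _ Hs Ht).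
      destruct (Nat.lt_total s t) as [h'|[<-|h']]; [|reflexivity|];
        apply Hainj in h'; lia.
    - exists czero; split; [|now left].
      intros s Hs; exfalso; apply Hn; now exists s. }
  assert (Hcase : forall n, x n = czero \/ exists s, hits (a s) n /\ x n = p s).
  { intros n; destruct (Hx n) as [H1 [H2|[s Hs]]]; [now left|right].
    exists s; split; [exact Hs|now apply H1]. }
  assert (Hx3 : forall n, from3 (x n)).
  { intros n; destruct (Hcase n) as [->|[s [_ ->]]]; [easy|apply Hp]. }
  set (y := fun i n => Nat.iter n dbl (x (i + n)%nat)).
  assert (Hdisj : forall i m n j, (m < n)%nat -> y i m j = 0%C \/ y i n j = 0%C).
  { intros i m n j Hmn; apply NNPP; intros H; apply not_or_and in H; destruct H as [H1 H2].
    apply iter_dbl_neq0 in H1; destruct H1 as [k [Hk Hxk]].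
    apply iter_dbl_neq0 in H2; destruct H2 as [k' [Hk' Hxk']].
    destruct (Hcase (i + m)%nat) as [h|[s [Hs h]]]; rewrite h in Hxk; [now apply Hxk|].
    destruct (Hcase (i + n)%nat) as [h'|[t [Ht h']]]; rewrite h' in Hxk'; [now apply Hxk'|].
    assert (Hsep := hits_separated _ _ _ _ Hs Ht ltac:(lia)).
    apply (Ha s (a s) (le_n _)) in Hxk.
    assert (k' <> 0)%nat by (intros ->; now apply Hxk', Hp; lia).
    assert (2 ^ (a s + m) <= 2 ^ n)%nat by (apply Nat.pow_le_mono_r; lia).
    rewrite Nat.pow_add_r in *.
    assert (2 ^ m <> 0)%nat by (apply Nat.pow_nonzero; lia).
    nia. }
  set (e := fun n => rsum (fun s => if (a s <=? n)%nat then E s n else 0) (S n)).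
  assert (Hterm : forall s n, 0 <= if (a s <=? n)%nat then E s n else 0).
  { intros s n; destruct (a s <=? n)%nat; [apply HE0|lra]. }
  assert (He0 : forall n, 0 <= e n) by (intros n; apply rsum_ge0; intros; apply Hterm).
  assert (HEe : forall s n, (a s <= n)%nat -> E s n <= e n).
  { intros s n Hsn.
    replace (E s n) with (if (a s <=? n)%nat then E s n else 0)
      by now rewrite (proj2 (Nat.leb_le _ _) Hsn).
    apply (rsum_term_le (fun s => if (a s <=? n)%nat then E s n else 0)).
    - intros; apply Hterm.
    - specialize (Hage s); lia. }
  assert (He2 : forall N, rsum e N <= 2).
  { intros N; apply Rle_trans with
      (rsum (fun n => rsum (fun s => if (a s <=? n)%nat then E s n else 0) N) N).
    - apply rsum_le; intros n Hn; apply rsum_monotone; [intros; apply Hterm|lia].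
    - rewrite rsum_exchange; eapply Rle_trans; [|apply (rsum_half_pow N)].
      apply rsum_le; intros s _; apply (Ha s (a s) (le_n _)). }
  set (f := diag_sum (y 0%nat)).
  assert (Hf : inX w f).
  { apply inX_intro with 1 2; [exact Hw| | |].
    - intros j Hj; apply csum_eq0; intros n _; apply iter_dbl_low; [apply Hx3|lia].
    - intros j; apply csum_disjoint_bound.
      + intros; now apply Hdisj.
      + assert (H := pos_INR j); lra.
      + intros n Hn; apply Rle_trans with (INR n).
        * apply iter_dbl_bound; [apply pos_INR|]; intros k.
          destruct (Hcase (0 + n)%nat) as [->|[s [Hs ->]]].
          -- unfold czero; rewrite Cmod_0; apply pos_INR.
          -- apply hits_ge in Hs; now apply (Ha s n).
        * apply Rle_trans with (INR j); [apply le_INR; lia|lra].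
    - intros J; eapply Rle_trans; [|apply (He2 J)].
      apply sqn_diag_sum_le; [exact Hv0|apply Hdisj|]; intros n; unfold y.
      destruct (Hcase (0 + n)%nat) as [->|[s [Hs ->]]].
      + eapply Rle_trans; [apply (sqn_iter_dbl_le v czero n 0); [exact Hv0|reflexivity]|].
        apply He0.
      + eapply Rle_trans; [apply HE|apply HEe]; now apply hits_ge in Hs. }
  exists f; split; [exact Hf|]; intros U [HUX HU] [g Hg].
  destruct (HU g Hg) as [eps [Heps Hball]]; specialize (HUX g Hg).
  assert (Heps2 : 0 < eps ^ 2) by (apply pow_lt; lra).
  destruct (rsum_tail_small e 2 He0 He2 (eps ^ 2 / 8)) as [L HL]; [lra|].
  destruct (Hdense g (xnorm w g ^ 2) (proj1 HUX) (inX_sqn w g Hw HUX) (eps ^ 2 / 8) L)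
    as [s [HsL Hs]]; [lra|].
  apply orbit_hits_open with w g (a s) eps; auto; intros n J Hn.
  assert (Hxn : x n = p s) by now apply (Hx n).
  assert (Horbit : Nat.iter n Top f = diag_sum (y n)).
  { apply (iter_Top_diag_sum x n); [exact Hx3|]; intros m Hm.
    destruct (Hcase m) as [->|[t [Ht ->]]]; [apply iter_Top_0|].
    assert (Hsep := hits_separated _ _ _ _ Ht Hn Hm).
    apply (Ha t (n - m)%nat); lia. }
  set (y' := fun k => match k with O => czero | _ => y n k end).
  assert (Hsplit : csub (Nat.iter n Top f) g = cadd (diag_sum y') (csub (p s) g)).
  { rewrite Horbit, <- Hxn; apply functional_extensionality; intros j.
    unfold csub, cadd, diag_sum; rewrite !csum_shift; unfold y', y, czero; cbn [Nat.iter].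
    rewrite Nat.add_0_r; simpl (Nat.iter 0 dbl (x n)); ring. }
  rewrite Hsplit; eapply Rle_trans; [now apply sqn_add_le|].
  specialize (Hs J); fold v.
  assert (Htail : sqn v (diag_sum y') J <= eps ^ 2 / 8); [|lra].
  eapply Rle_trans; [|apply (HL L J (le_n L))].
  apply sqn_diag_sum_le; [exact Hv0| |].
  - intros [|m] k j Hmk; [now left|]; destruct k as [|k]; [lia|].
    now apply (Hdisj n (S m) (S k)).
  - intros k; assert (Hb : 0 <= if (L <=? k)%nat then e k else 0).
    { destruct (L <=? k)%nat; [apply He0|lra]. }
    destruct k as [|k]; [now unfold y'; rewrite sqn_zero|]; unfold y', y.
    destruct (Hcase (n + S k)%nat) as [->|[t [Ht ->]]].
    + eapply Rle_trans;
        [apply (sqn_iter_dbl_le v czero (S k) 0); [exact Hv0|reflexivity]|exact Hb].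
    + assert (Hsep := hits_separated _ _ _ _ Hn Ht ltac:(lia)).
      specialize (Hage s).
      destruct (Nat.leb_spec L (S k)); [|lia].
      eapply Rle_trans; [apply HE|apply HEe; lia].
Qed.

Lemma rsum_even_le (u : nat -> R) (n : nat) :
  (forall i, 0 <= u i) -> rsum (fun i => u (2 * i)%nat) n <= rsum u (2 * n).
Proof.
  intros Hu; rewrite rsum_double.
  assert (0 <= rsum (fun i => u (2 * i + 1)%nat) n) by (apply rsum_ge0; auto); lra.
Qed.

Lemma rsum_odd_part_le (u : nat -> R) (n : nat) :
  (forall i, 0 <= u i) ->
  rsum (fun k => if (k mod 3 =? 2)%nat then u (2 * (k / 3) + 1)%nat else 0) n <=
  rsum u (2 * n).
Proof.
  intros Hu.
  set (h := fun k => if (k mod 3 =? 2)%nat then u (2 * (k / 3) + 1)%nat else 0).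
  assert (H3 : rsum h (3 * n) = rsum (fun i => u (2 * i + 1)%nat) n).
  { induction n as [|n IH]; [reflexivity|].
    replace (3 * S n)%nat with (S (S (S (3 * n)))) by lia; cbn [rsum]; rewrite IH.
    assert (H : forall r, (r < 3)%nat ->
      h (3 * n + r)%nat = if (r =? 2)%nat then u (2 * n + 1)%nat else 0).
    { intros r Hr; unfold h.
      assert (Hm : ((3 * n + r) mod 3 = r)%nat).
      { symmetry; apply Nat.mod_unique with n; lia. }
      assert (Hq : ((3 * n + r) / 3 = n)%nat).
      { symmetry; apply Nat.div_unique with r; lia. }
      now rewrite Hm, Hq. }
    assert (H0 := H 0%nat ltac:(lia)); assert (H1 := H 1%nat ltac:(lia));
      assert (H2 := H 2%nat ltac:(lia)); simpl (_ =? _)%nat in H0, H1, H2.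
    replace (3 * n + 0)%nat with (3 * n)%nat in H0 by lia.
    replace (3 * n + 1)%nat with (S (3 * n)) in H1 by lia.
    replace (3 * n + 2)%nat with (S (S (3 * n))) in H2 by lia.
    rewrite H0, H1, H2; ring. }
  apply Rle_trans with (rsum h (3 * n)).
  - apply rsum_monotone; [|lia]; intros i; unfold h; destruct (i mod 3 =? 2)%nat; auto; lra.
  - rewrite H3, rsum_double.
    assert (0 <= rsum (fun i => u (2 * i)%nat) n) by (apply rsum_ge0; auto); lra.
Qed.

Lemma omega0_pos (n : nat) : 0 < omega0 n.
Proof.
  apply Rdiv_lt_0_compat; [assert (H := pos_INR n); lra|apply PI_RGT_0].
Qed.

Lemma omega0_lower (n : nat) : / PI <= omega0 n.
Proof.
  unfold omega0, Rdiv; assert (H := pos_INR n).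
  assert (0 < / PI) by (apply Rinv_0_lt_compat, PI_RGT_0); nra.
Qed.

Lemma inv_omega0_le (m n : nat) (a : R) :
  0 <= a -> INR n + 1 <= a * (INR m + 1) -> / omega0 m <= a * / omega0 n.
Proof.
  intros Ha H; unfold omega0.
  assert (HP := PI_RGT_0); assert (Hm := pos_INR m); assert (Hn := pos_INR n).
  replace (/ ((INR m + 1) / PI)) with (PI * (/ (INR m + 1))) by (field; lra).
  replace (a * / ((INR n + 1) / PI)) with (PI * (a * / (INR n + 1))) by (field; lra).
  apply Rmult_le_compat_l; [lra|].
  apply Rmult_le_reg_r with ((INR m + 1) * (INR n + 1)); [nra|].
  replace (/ (INR m + 1) * ((INR m + 1) * (INR n + 1))) with (INR n + 1) by (field; lra).
  replace (a * / (INR n + 1) * ((INR m + 1) * (INR n + 1))) with (a * (INR m + 1))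
    by (field; lra).
  exact H.
Qed.

Lemma omega0_summable (k : nat) :
  (3 <= k)%nat -> ex_series (fun n => / omega0 (k * 2 ^ n)%nat).
Proof.
  intros Hk.
  apply (@ex_series_le R_AbsRing R_CompleteNormedModule)
    with (b := fun n => / omega0 0 * (1 / 2) ^ n).
  - intros n; change (Rabs (/ omega0 (k * 2 ^ n)) <= / omega0 0 * (1 / 2) ^ n).
    rewrite Rabs_pos_eq by (left; apply Rinv_0_lt_compat, omega0_pos).
    rewrite Rmult_comm; apply inv_omega0_le; [apply pow_le; lra|].
    rewrite mult_INR, pow_INR; simpl (INR 0); simpl (INR 2).
    assert (H3 : 3 <= INR k) by (apply (le_INR 3) in Hk; simpl in Hk; lra).
    assert (Hp : 0 < (1 / 2) ^ n) by (apply pow_lt; lra).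
    assert (He : (1 / 2) ^ n * (1 + 1) ^ n = 1).
    { rewrite <- Rpow_mult_distr; replace (1 / 2 * (1 + 1)) with 1 by field; apply pow1. }
    nra.
  - apply (@ex_series_scal R_AbsRing R_NormedModule), ex_series_geom.
    rewrite Rabs_pos_eq; lra.
Qed.

Lemma Top_inX_omega0 (c : coef) : inX omega0 c -> inX omega0 (Top c).
Proof.
  intros Hc.
  assert (Hpos : forall n, (1 <= n)%nat -> 0 < omega0 n) by (intros; apply omega0_pos).
  set (v := inv_weight omega0).
  assert (Hv0 : forall n, 0 <= v n) by (intros; now apply inv_weight_ge0).
  set (u := fun j => Cmod (c j) ^ 2 * v j).
  assert (Hu : forall j, 0 <= u j) by (intros; now apply sqn_term_ge0).
  set (M := xnorm omega0 c ^ 2).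
  assert (HM : forall J, rsum u J <= M) by (apply inX_sqn; assumption).
  assert (HT3 : from3 (Top c)).
  { intros n Hn; rewrite Top_eq; now rewrite (proj2 (Nat.ltb_lt n 3) Hn). }
  assert (HTM : forall J, sqn v (Top c) J <= 6 * M).
  { intros J; apply Rle_trans with (rsum (fun k => 4 * u (2 * k)%nat +
        2 * (if (k mod 3 =? 2)%nat then u (2 * (k / 3) + 1)%nat else 0)) J).
    - apply rsum_le; intros k _.
      assert (Hodd : 0 <= if (k mod 3 =? 2)%nat then u (2 * (k / 3) + 1)%nat else 0).
      { destruct (k mod 3 =? 2)%nat; auto; lra. }
      rewrite Top_eq; destruct (Nat.ltb_spec k 3) as [h|h].
      + rewrite Cmod_0; specialize (Hu (2 * k)%nat); lra.
      + apply Rle_trans with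
          ((2 * Cmod (c (2 * k)%nat) ^ 2 + 2 * Cmod (odd_part c k) ^ 2) * v k).
        { apply Rmult_le_compat_r; [apply Hv0|apply Cmod_add_sqr_le]. }
        assert (H1 : Cmod (c (2 * k)%nat) ^ 2 * v k <= 2 * u (2 * k)%nat).
        { unfold u; rewrite (Rmult_comm 2), Rmult_assoc.
          apply Rmult_le_compat_l; [apply pow2_ge_0|]; rewrite Rmult_comm.
          destruct k as [|k]; [lia|].
          apply (inv_omega0_le (S k) (2 * S k)); [lra|].
          rewrite mult_INR; simpl (INR 2); lra. }
        assert (H2 : Cmod (odd_part c k) ^ 2 * v k <=
                     if (k mod 3 =? 2)%nat then u (2 * (k / 3) + 1)%nat else 0).
        { unfold odd_part, u; destruct (k mod 3 =? 2)%nat; [|rewrite Cmod_0; lra].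
          apply Rmult_le_compat_l; [apply pow2_ge_0|].
          assert (Hdiv := Nat.div_mod_eq k 3).
          assert (Hle : (2 * (k / 3) + 1 <= k)%nat) by lia.
          replace (2 * (k / 3) + 1)%nat with (S (2 * (k / 3))) in * by lia.
          destruct k as [|k]; [lia|].
          rewrite <- (Rmult_1_l (v (S (2 * _)))).
          apply inv_omega0_le; [lra|]; apply le_INR in Hle; lra. }
        lra.
    - rewrite rsum_plus, !rsum_scal.
      assert (H1 := rsum_even_le u J Hu); assert (H2 := rsum_odd_part_le u J Hu).
      specialize (HM (2 * J)%nat); lra. }
  apply inX_intro with (1 + 6 * M / PI) (6 * M); auto.
  intros n; assert (Hn := pos_INR n); assert (HP := PI_RGT_0).
  assert (HM0 : 0 <= M) by apply pow2_ge_0.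
  destruct n as [|n].
  - rewrite HT3, Cmod_0 by lia; apply Rmult_le_pos; [|lra].
    assert (0 <= 6 * M / PI) by (apply Rdiv_le_0_compat; lra); lra.
  - assert (H : Cmod (Top c (S n)) ^ 2 * v (S n) <= 6 * M).
    { eapply Rle_trans; [|apply (HTM (S (S n)))].
      apply (rsum_term_le (fun j => Cmod (Top c j) ^ 2 * v j)); [|lia].
      intros; now apply sqn_term_ge0. }
    assert (Hq : Cmod (Top c (S n)) ^ 2 <= 6 * M / PI * (INR (S n) + 1)).
    { apply (Rmult_le_compat_r (omega0 (S n))) in H; [|left; apply omega0_pos].
      unfold v in H; simpl inv_weight in H.
      rewrite Rmult_assoc, Rinv_l, Rmult_1_r in H by (apply Rgt_not_eq, omega0_pos).
      unfold omega0, Rdiv in *; lra. }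
    assert (0 <= (Cmod (Top c (S n)) - 1) ^ 2) by apply pow2_ge_0.
    assert (0 <= 6 * M / PI) by (apply Rdiv_le_0_compat; lra).
    nra.
Qed.

Theorem theorem3p16 :
  (forall w : nat -> R,
     (forall n, (1 <= n)%nat -> 0 < w n) ->
     (exists d, 0 < d /\ forall n, (1 <= n)%nat -> d <= w n) ->
     (forall k, (3 <= k)%nat -> ex_series (fun n => / w (k * 2 ^ n)%nat)) ->
     Top_bounded w ->
     frequently_hypercyclic w)
  /\ frequently_hypercyclic omega0.
Proof.
  split.
  - intros w Hw Hd Hser [HT _]; now apply frequently_hypercyclic_of_summable.
  - apply frequently_hypercyclic_of_summable.
    + intros n _; apply omega0_pos.
    + exists (/ PI); split; [apply Rinv_0_lt_compat, PI_RGT_0|].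
      intros n _; apply omega0_lower.
    + exact omega0_summable.
    + exact Top_inX_omega0.
Qed.
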